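(* Let $n\in\{1,2,\dots\}$, let $K_{2n}$ be a complete network on $2n$ nodes (arcs may have different lengths) of total length $\mu$, and let $F=\{F_1,\dots,F_{2n-1}\}$ be a 1-factorization of $K_{2n}$. Let $\delta(F)=\max_{1\le i\le 2n-1}\lambda(F_i)$. If the attack duration satisfies $\alpha\le\mu-\delta(F)$, then in the continuous patrolling game on $K_{2n}$ the complete network patrolling strategy $S^F$ is optimal for the Patroller, the uniform attack strategy is optimal for the Attacker, and the value of the game is $V=\alpha/\mu$.
   Context: **Networks.** A network $Q$ is a finite connected graph whose arcs are viewed as open intervals of positive finite length, with a node at each end of each arc. $\lambda$ denotes the length measure on $Q$ (nodes have measure $0$), $\mu=\lambda(Q)$, and $d(x,y)$ is the length of a shortest path between $x,y\in Q$. A complete network is one in which every pair of distinct nodes is joined by exactly one arc, with no loops. **Continuous patrolling game.** The parameter $\alpha$ satisfies $0<\alpha\le$ the minimum length of a closed walk covering $Q$. The Attacker chooses a point $x\in Q$ and a start time $t\ge 0$. The Patroller chooses a patrol, i.e. a path $S:[0,\infty)\to Q$ of speed at most one: $d(S(s),S(s'))\le |s-s'|$ for all $s,s'$. The attack is intercepted (payoff $1$ to the Patroller) if $x\in S([t,t+\alpha])$; otherwise the payoff is $0$. The game is zero-sum, the Patroller maximizes the interception probability and the Attacker minimizes it; both may use mixed strategies. The value $V$ is the common value of the sup (over mixed Patroller strategies) inf (over attacks) and the inf (over mixed Attacker strategies) sup (over patrols) of the interception probability. A Patroller strategy is optimal if it intercepts every attack with probability at least $V$; an Attacker strategy is optimal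 if every patrol intercepts it with probability at most $V$. **1-factorization.** A 1-factorization of $K_{2n}$ is a set $F=\{F_1,\dots,F_{2n-1}\}$ of perfect matchings (spanning 1-regular sub-networks) whose arc sets are pairwise disjoint and have union the whole arc set of $K_{2n}$. **Complete network patrolling strategy $S^F$.** For each $i$ let $Q_i=K_{2n}-F_i$ be the sub-network obtained by deleting the arcs of $F_i$ (all nodes are kept); $Q_i$ is $(2n-2)$-regular and hence Eulerian. Let $S_i$ be the randomized patrol that follows an Eulerian tour of $Q_i$ at unit speed, repeated periodically forever, starting at a uniformly random point of the tour. $S^F$ chooses $S_i$ with probability $s_i=\lambda(Q_i)/((2n-2)\mu)$, $i=1,\dots,2n-1$. (For $n=1$ the condition $\alpha\le\mu-\delta(F)$ is never satisfied.) **Uniform attack strategy.** The attack begins at an arbitrary fixed time (e.g. time $0$) at a point of the network chosen uniformly at random with respect to $\lambda$. *)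

(* Defs.v *)
From HB Require Import structures.
From mathcomp Require Import all_boot all_order all_algebra.
From mathcomp Require Import all_classical all_reals all_analysis.
From mathcomp Require Import measurable_realfun.
From mathcomp Require Import lra.

Set Implicit Arguments.
Unset Strict Implicit.
Unset Printing Implicit Defensive.

Import Order.TTheory GRing.Theory Num.Theory.
Import numFieldNormedType.Exports.

Local Open Scope ring_scope.

(* Each arc carries an arbitrary orientation [src] -> [tgt], used only to
   parametrize it by [0, len]. Loops and parallel arcs are allowed. *)
Record network (R : realType) := Network {
  node : finType;
  arcs : finType;
  src : arcs -> node;
  tgt : arcs -> node;
  len : arcs -> R;
  len_gt0 : forall a, 0 < len a;
  node_inhabited : (0 < #|node|)%N;
  network_connected : forall u v,
    connect [rel x y | [exists a, ((src a == x) && (tgt a == y)) ||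
                                  ((src a == y) && (tgt a == x))]] u v }.

Section NetworkGraph.
Context {R : realType} (Q : network R).

Definition joins (a : arcs Q) (u v : node Q) : bool :=
  ((src a == u) && (tgt a == v)) || ((src a == v) && (tgt a == u)).

Definition incident (v : node Q) (a : arcs Q) : bool :=
  (src a == v) || (tgt a == v).

Definition complete_network : Prop :=
  (forall a : arcs Q, src a != tgt a) /\
  (forall u v : node Q, u != v -> #|[set a | joins a u v]%SET| = 1%N).

Definition perfect_matching (M : {set arcs Q}) : Prop :=
  forall v : node Q, #|[set a in M | incident v a]%SET| = 1%N.

Definition one_factorization k (F : 'I_k -> {set arcs Q}) : Prop :=
  [/\ forall i, perfect_matching (F i),
      forall i j, i != j -> [disjoint F i & F j] &
      forall a, exists i, a \in F i].

(* The length measure of a sub-network given by its arcs; see [lamE]. *)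
Definition arcs_length (H : {set arcs Q}) : R := \sum_(a in H) len a.

Definition total_length : R := arcs_length [set: arcs Q]%SET.

Lemma len_ge0 (a : arcs Q) : 0 <= len a.
Proof. exact/ltW/len_gt0. Qed.

Lemma arcs_length_ge0 (H : {set arcs Q}) : 0 <= arcs_length H.
Proof. by apply: sumr_ge0 => a _; exact: len_ge0. Qed.

(* An arc with a direction of travel: [(a, true)] goes from [src] to [tgt]. *)
Definition dart := (arcs Q * bool)%type.
Definition dsrc (e : dart) : node Q := if e.2 then src e.1 else tgt e.1.
Definition dtgt (e : dart) : node Q := if e.2 then tgt e.1 else src e.1.

Record closed_walk := ClosedWalk {
  darts :> seq dart;
  darts_cycle : cycle [rel e e' | dtgt e == dsrc e'] darts }.

Definition walk_length (c : seq dart) : R := \sum_(e <- c) len e.1.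

Definition covering (c : closed_walk) : Prop :=
  forall a : arcs Q, a \in map fst (darts c).

Definition eulerian_tour (H : {set arcs Q}) (c : closed_walk) : Prop :=
  uniq (map fst (darts c)) /\ map fst (darts c) =i H.

Lemma walk_length_ge0 c : 0 <= walk_length c.
Proof. by apply: sumr_ge0 => e _; exact: len_ge0. Qed.

End NetworkGraph.

Local Open Scope classical_set_scope.

Section Points.
Context {R : realType} (Q : network R).

Inductive netpoint : Type :=
| Node of node Q
| Inner (a : arcs Q) (s : R) of (0 < s < len a).

(* The parametrization of the closed arc [a] by [0, len a], extended by its
   end values to the whole of R. *)
Definition arc_pt (a : arcs Q) (s : R) : netpoint :=
  if s <= 0 then Node (src a) else
  if pselect (0 < s < len a) is left h then Inner h else Node (tgt a).

Lemma arc_ptE (a : arcs Q) (s : R) (h : 0 < s < len a) : arc_pt a s = Inner h.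
Proof.
have s0 : (s <= 0) = false by case/andP: (h) => /lt_geF.
by rewrite /arc_pt s0; case: pselect => // h'; rewrite (bool_irrelevance h' h).
Qed.

Lemma arc_pt0 (a : arcs Q) : arc_pt a 0 = Node (src a).
Proof. by rewrite /arc_pt lexx. Qed.

Lemma arc_pt_len (a : arcs Q) : arc_pt a (len a) = Node (tgt a).
Proof.
rewrite /arc_pt lt_geF ?len_gt0//; case: pselect => // h.
by exfalso; move: h; rewrite ltxx andbF.
Qed.

(* [path_len x y l]: some path from x to y, made of finitely many segments each
   contained in a closed arc, has length l. As Q is connected, the infimum
   [dist] below is the length of a shortest path. *)
Inductive path_len : netpoint -> netpoint -> R -> Prop :=
| path_nil x : path_len x x 0
| path_cons a s t y l :
    0 <= s <= len a -> 0 <= t <= len a -> path_len (arc_pt a t) y l ->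
    path_len (arc_pt a s) y (`|s - t| + l).

Definition dist (x y : netpoint) : R := inf [set l | path_len x y l].

HB.instance Definition _ := gen_eqMixin netpoint.
HB.instance Definition _ := gen_choiceMixin netpoint.

Lemma node_exists : exists v : node Q, true.
Proof. by have /card_gt0P[v _] := node_inhabited Q; exists v. Qed.

HB.instance Definition _ := isPointed.Build netpoint
  (Node (xchoose node_exists)).

(* The Borel sigma-algebra of [dist]: the final one for the finitely many
   continuous maps [arc_pt a], whose images are the closed arcs. *)
Definition measurable_points : set (set netpoint) :=
  [set B | forall a : arcs Q, measurable (arc_pt a @^-1` B)].

Lemma measurable_points0 : measurable_points set0.
Proof. by move=> a; rewrite preimage_set0. Qed.

Lemma measurable_pointsC B : measurable_points B -> measurable_points (~` B).
Proof.
by move=> mB a; rewrite preimage_setC; apply: measurableC; exact: mB.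
Qed.

Lemma measurable_points_bigcup (B : (set netpoint)^nat) :
  (forall i, measurable_points (B i)) -> measurable_points (\bigcup_i B i).
Proof.
move=> mB a; rewrite preimage_bigcup.
by apply: bigcupT_measurable => i; exact: mB.
Qed.

HB.instance Definition _ := @isMeasurable.Build default_measure_display
  netpoint measurable_points measurable_points0 measurable_pointsC
  measurable_points_bigcup.

Lemma measurable_arc_pt (a : arcs Q) : measurable_fun [set: R] (arc_pt a).
Proof. by move=> _ B mB; rewrite setTI; exact: mB. Qed.

End Points.

Section FiniteSumMeasure.
Local Open Scope ereal_scope.
Context d (T : measurableType d) (R : realType) (I : finType).
Variable m : I -> {measure set T -> \bar R}.

Definition fin_msum (A : set T) : \bar R := \sum_(i : I) m i A.

Let fin_msum0 : fin_msum set0 = 0.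
Proof. by rewrite /fin_msum big1. Qed.

Let fin_msum_ge0 B : 0 <= fin_msum B.
Proof. by rewrite /fin_msum; apply: sume_ge0. Qed.

Let fin_msum_sigma_additive : semi_sigma_additive fin_msum.
Proof.
move=> F mF tF mUF; rewrite [X in _ --> X](_ : _ =
    lim ((fun n => \sum_(0 <= i < n) fin_msum (F i)) @ \oo)).
  by apply: is_cvg_ereal_nneg_natsum => k _; exact: sume_ge0.
rewrite nneseries_sum//; apply: eq_bigr => /= i _.
exact: measure_semi_bigcup.
Qed.

HB.instance Definition _ := isMeasure.Build _ _ _ fin_msum
  fin_msum0 fin_msum_ge0 fin_msum_sigma_additive.

End FiniteSumMeasure.

Section ImageMeasure.
Local Open Scope ereal_scope.
Context d d' (T : measurableType d) (T' : measurableType d') (R : realType).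
Variables (m : {measure set T -> \bar R}) (f : T -> T').
Variable mf : measurable_fun [set: T] f.

(* [pushforward] keeping the measurability proof, so that the result is
   canonically a measure. *)
Definition image_measure (_ : measurable_fun [set: T] f) : set T' -> \bar R :=
  pushforward m f.

Let image_measure0 : image_measure mf set0 = 0.
Proof. exact: measure0. Qed.

Let image_measure_ge0 A : 0 <= image_measure mf A.
Proof. exact: measure_ge0. Qed.

Let image_measure_sigma_additive : semi_sigma_additive (image_measure mf).
Proof. exact: measure_semi_sigma_additive. Qed.

HB.instance Definition _ := isMeasure.Build _ _ _ (image_measure mf)
  image_measure0 image_measure_ge0 image_measure_sigma_additive.

End ImageMeasure.

Section LengthMeasure.
Context {R : realType} (Q : network R).

Definition lam : set (netpoint Q) -> \bar R :=
  fin_msum (fun a : arcs Q =>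
    image_measure (mrestr (@lebesgue_measure R) (measurable_itv `]0, len a[%R))
      (measurable_arc_pt a)).

HB.instance Definition _ := Measure.on lam.

Definition subnetwork (H : {set arcs Q}) : set (netpoint Q) :=
  [set x | match x with Node _ => True | Inner a _ _ => a \in H end].

Lemma lamE (H : {set arcs Q}) : lam (subnetwork H) = (arcs_length H)%:E.
Proof.
rewrite /lam /fin_msum /arcs_length -sumEFin [RHS]big_mkcond/=.
apply: eq_bigr => a _; rewrite /image_measure /pushforward /mrestr.
set B := _ `&` _.
have -> : B = if a \in H then `]0, len a[%classic else set0.
  apply/seteqP; split=> s; rewrite /B /subnetwork /= in_itv/=.
    by move=> [+ h]; rewrite (arc_ptE h) => ->/=; rewrite in_itv.
  by case: ifP => //= aH; rewrite in_itv/= => h; rewrite (arc_ptE h).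
by case: ifP => // _; rewrite ?measure0// lebesgue_measure_itv/= lte_fin
  len_gt0 oppr0 adde0.
Qed.

End LengthMeasure.
Arguments lam {R} Q.

Section Tours.
Context {R : realType} (Q : network R).

Lemma path_len_ge0 (x y : netpoint Q) l : path_len x y l -> 0 <= l.
Proof. by elim=> // *; exact: addr_ge0. Qed.

Lemma dist_le (x y : netpoint Q) l : path_len x y l -> dist x y <= l.
Proof.
move=> xy; apply: ge_inf => //.
by exists 0 => r /path_len_ge0.
Qed.

Lemma path_len_cat (x y z : netpoint Q) l l' :
  path_len x y l -> path_len y z l' -> path_len x z (l + l').
Proof.
elim=> [?|a s t {}y r sa ta _ IH yz]; first by rewrite add0r.
by rewrite -addrA; apply: path_cons => //; exact: IH.
Qed.

Lemma path_len_sym (x y : netpoint Q) l : path_len x y l -> path_len y x l.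
Proof.
elim=> [z|a s t z r sa ta _ IH]; first exact: path_nil.
rewrite addrC; apply: (path_len_cat IH).
rewrite distrC -[`|_|]addr0; apply: path_cons => //; exact: path_nil.
Qed.

(* The point reached after time s on a dart travelled at unit speed. *)
Definition dart_pt (e : dart Q) (s : R) : netpoint Q :=
  arc_pt e.1 (if e.2 then s else len e.1 - s).

Lemma dart_pt0 e : dart_pt e 0 = Node (dsrc e).
Proof. by case: e => a []; rewrite /dart_pt/= ?subr0 ?arc_pt0 ?arc_pt_len. Qed.

Lemma dart_pt_len e : dart_pt e (len e.1) = Node (dtgt e).
Proof. by case: e => a []; rewrite /dart_pt/= ?subrr ?arc_pt0 ?arc_pt_len. Qed.

Lemma dart_pt_path e (s t : R) : 0 <= s -> s <= t -> t <= len e.1 ->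
  path_len (dart_pt e s) (dart_pt e t) (t - s).
Proof.
move=> s0 st tl; case: e tl => a b /= tl; rewrite -[t - s]addr0.
case: b; rewrite /dart_pt/=.
- rewrite (_ : t - s = `|s - t|); last by rewrite distrC ger0_norm ?subr_ge0.
  by apply: path_cons; [lra|lra|exact: path_nil].
- rewrite (_ : t - s = `|(len a - s) - (len a - t)|); last first.
    by rewrite ger0_norm; lra.
  by apply: path_cons; [lra|lra|exact: path_nil].
Qed.

(* The point reached after time s on the darts of c, travelled in order at unit
   speed; p is the end point, where the motion stops. *)
Fixpoint walk_pos (p : netpoint Q) (c : seq (dart Q)) (s : R) : netpoint Q :=
  if c is e :: c' then
    if s <= len e.1 then dart_pt e s
    else walk_pos (Node (dtgt e)) c' (s - len e.1)
  else p.

Definition dart_chain (u : node Q) (c : seq (dart Q)) : bool :=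
  (if c is e :: _ then dsrc e == u else true) &&
  sorted [rel e e' | dtgt e == dsrc e'] c.

Lemma dart_chain_cons u e c :
  dart_chain u (e :: c) = (dsrc e == u) && dart_chain (dtgt e) c.
Proof. by case: c => [|f c]; rewrite /dart_chain/= // [dtgt e == _]eq_sym. Qed.

Lemma walk_pos0 u c : dart_chain u c -> walk_pos (Node u) c 0 = Node u.
Proof.
case: c => //= e c; rewrite dart_chain_cons => /andP[/eqP <- _].
by rewrite len_ge0 dart_pt0.
Qed.

Lemma walk_pos_path u c (s t : R) : dart_chain u c -> 0 <= s -> s <= t ->
  exists2 l, path_len (walk_pos (Node u) c s) (walk_pos (Node u) c t) l &
             l <= t - s.
Proof.
elim: c u s t => [|e c IH] u s t /=.
  by move=> _ _ st; exists 0; [exact: path_nil|rewrite subr_ge0].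
rewrite dart_chain_cons => /andP[/eqP eu cc] s0 st.
have [tl|lt] := leP t (len e.1).
  rewrite (le_trans st tl); exists (t - s) => //.
  exact: dart_pt_path.
have [sl|ls] := leP s (len e.1); last first.
  by have [||l pl ll] := IH (dtgt e) (s - len e.1) (t - len e.1) cc;
    [lra|lra|exists l => //; lra].
have [||l] := IH (dtgt e) 0 (t - len e.1) cc => //; first lra.
rewrite walk_pos0// -dart_pt_len => pl ll.
exists ((len e.1 - s) + l); last lra.
apply: path_len_cat pl.
exact: dart_pt_path.
Qed.

Lemma walk_pos_end u c : dart_chain u c ->
  walk_pos (Node u) c (walk_length c) = Node (last u (map (@dtgt _ Q) c)).
Proof.
elim: c u => [//|e c IH] u; rewrite dart_chain_cons => /andP[/eqP <- cc] /=.
have := IH _ cc; rewrite /walk_length big_cons addrC addrK => ih.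
have [|] := leP; last by rewrite ih.
rewrite -lerBrDr subrr => l0.
have {}l0 : walk_length c = 0 by apply/le_anti; rewrite l0 walk_length_ge0.
move: ih; rewrite -/(walk_length c) l0 walk_pos0// => <-.
by rewrite add0r dart_pt_len.
Qed.

Definition tour_base (c : closed_walk Q) : node Q :=
  if darts c is e :: _ then dsrc e else xchoose (node_exists Q).

Lemma tour_chain (c : closed_walk Q) : dart_chain (tour_base c) c.
Proof.
rewrite /tour_base; have := darts_cycle c; case: (darts c) => //= e c'.
by rewrite rcons_path /dart_chain/= eqxx => /andP[].
Qed.

Lemma tour_end (c : closed_walk Q) :
  walk_pos (Node (tour_base c)) c (walk_length c) = Node (tour_base c).
Proof.
rewrite walk_pos_end ?tour_chain//; congr Node.
rewrite /tour_base; have := darts_cycle c; case: (darts c) => //= e c'.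
by rewrite rcons_path => /andP[_ /eqP <-]; rewrite last_map.
Qed.

(* s modulo L, in [0, L[ (for L > 0). *)
Definition modr (s L : R) : R := s - L * (Num.floor (s / L))%:~R.

(* The point reached at time s (in R) when the closed walk c is followed
   periodically at unit speed, being at its first node at time 0. *)
Definition tour_pos (c : closed_walk Q) (s : R) : netpoint Q :=
  walk_pos (Node (tour_base c)) c (modr s (walk_length c)).

Lemma tour_pos_path (c : closed_walk Q) (s t : R) : s <= t ->
  exists2 l, path_len (tour_pos c s) (tour_pos c t) l & l <= t - s.
Proof.
rewrite /tour_pos; have := tour_chain c; have := tour_end c.
move: (tour_base c) => u; set L := walk_length c => cL cc st.
have : 0 <= L by exact: walk_length_ge0.
rewrite le_eqVlt => /predU1P[L0|L0].
  exists 0; last by rewrite subr_ge0.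
  rewrite /modr -L0 !mul0r !subr0.
  case: (darts c) @L cL L0 cc => [*|e c' L _]; first exact: path_nil.
  rewrite /L /walk_length big_cons => /eqP; rewrite eq_sym.
  have := len_gt0 e.1; have := walk_length_ge0 c'; rewrite /walk_length.
  by move=> + + /eqP; lra.
have fl r : [/\ 0 <= modr r L, modr r L <= L &
    r = modr r L + L * (Num.floor (r / L))%:~R].
  have /andP[f1 f2] := floor_itv (r / L).
  move: f1 f2; rewrite ler_pdivlMr// ltr_pdivrMr// intrD mulrDl mul1r.
  by rewrite /modr mulrC => f1 f2; split; lra.
have [s0 sL sE] := fl s; have [t0 tL tE] := fl t.
have : (Num.floor (s / L) <= Num.floor (t / L)).
  by apply: le_floor; rewrite ler_pM2r ?invr_gt0.
rewrite le_eqVlt => /predU1P[st'|st'].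
  have [|l pl ll] := walk_pos_path cc s0 (t := modr t L).
    by move: sE tE; rewrite st'; lra.
  by exists l => //; move: sE tE; rewrite st'; lra.
have [l1 p1 h1] := walk_pos_path cc s0 sL.
have [l2 p2 h2] := walk_pos_path cc (lexx 0) t0.
move: p1 p2; rewrite cL walk_pos0// => p1 p2.
exists (l1 + l2); first exact: path_len_cat p1 p2.
move: sE tE.
have : L * (Num.floor (s / L) + 1)%:~R <= L * (Num.floor (t / L))%:~R.
  by rewrite ler_pM2l// ler_int lezD1.
by rewrite intrD mulrDr mulr1; lra.
Qed.

Lemma measurable_modr L : measurable_fun [set: R] (modr ^~ L).
Proof.
rewrite /modr; apply: measurable_funB => //.
apply: measurable_funM => //.
apply: (measurableT_comp (f := fun r : R => (Num.floor r)%:~R : R)).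
  apply: nondecreasing_measurable => // x y xy.
  by rewrite ler_int le_floor.
exact: measurable_funM.
Qed.

Lemma measurable_dart_pt e : measurable_fun [set: R] (dart_pt e).
Proof.
apply: (measurableT_comp (measurable_arc_pt _)).
by case: e.2 => //; exact: measurable_funB.
Qed.

Lemma measurable_walk_pos p c : measurable_fun [set: R] (walk_pos p c).
Proof.
elim: c p => [|e c IH] p /=; first exact: measurable_cst.
apply: measurable_fun_ifT.
- exact: measurable_fun_ler.
- exact: measurable_dart_pt.
- apply: measurableT_comp; first exact: IH.
  exact: measurable_funB.
Qed.

Lemma measurable_tour_pos c : measurable_fun [set: R] (tour_pos c).
Proof.
exact: (measurableT_comp (measurable_walk_pos _ _) (measurable_modr _)).
Qed.

End Tours.

Section Game.
Context {R : realType} (Q : network R).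

(* A patrol is a path on [0, oo[ of speed at most one; the values at negative
   times are irrelevant. *)
Record patrol := Patrol {
  patrol_pos :> R -> netpoint Q;
  patrol_speed : forall s s', 0 <= s -> 0 <= s' ->
    dist (patrol_pos s) (patrol_pos s') <= `|s - s'| }.

Lemma tour_speed (c : closed_walk Q) (r s s' : R) :
  dist (tour_pos c (r + s)) (tour_pos c (r + s')) <= `|s - s'|.
Proof.
have [ss'|/ltW s's] := leP s s'.
  have [|l pl ll] := @tour_pos_path _ _ c (r + s) (r + s').
    by rewrite lerD2l.
  by rewrite distrC ger0_norm ?subr_ge0//; apply: (le_trans (dist_le pl)); lra.
have [|l pl ll] := @tour_pos_path _ _ c (r + s') (r + s).
    by rewrite lerD2l.
rewrite ger0_norm ?subr_ge0//.
by apply: (le_trans (dist_le (path_len_sym pl))); lra.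
Qed.

(* Starts at distance [walk_length c * u] along c from its first node. *)
Definition tour_patrol (c : closed_walk Q) (u : R) : patrol :=
  @Patrol (fun s => tour_pos c (walk_length c * u + s))
    (fun s s' _ _ => tour_speed c (walk_length c * u) s s').

HB.instance Definition _ := gen_eqMixin patrol.
HB.instance Definition _ := gen_choiceMixin patrol.
HB.instance Definition _ := isPointed.Build patrol
  (tour_patrol (@ClosedWalk _ Q [::] isT) 0).

(* The sigma-algebra generated by the positions at times t >= 0. As patrols are
   1-Lipschitz and points form a compact metric space, it is the Borel
   sigma-algebra of the topology of uniform convergence on compact sets. *)
Definition patrol_cylinders : set (set patrol) :=
  [set C | exists t (B : set (netpoint Q)),
    [/\ 0 <= t, measurable B & C = [set S : patrol | B (S t)]]].

HB.instance Definition _ := @isMeasurable.Build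
  (sigma_display patrol_cylinders) patrol <<s patrol_cylinders >>
  (@sigma_algebra0 _ setT patrol_cylinders)
  (@sigma_algebraC _ patrol_cylinders)
  (@sigma_algebra_bigcup _ setT patrol_cylinders).

Lemma measurable_tour_patrol c : measurable_fun [set: R] (tour_patrol c).
Proof.
apply: (@measurability _ _ _ _ _ _ patrol_cylinders) => //.
move=> _ [_ [t [B [t0 mB ->]]] <-]; rewrite setTI.
have : measurable_fun [set: R] (fun u => tour_pos c (walk_length c * u + t)).
  apply: measurableT_comp; first exact: measurable_tour_pos.
  by apply: measurable_funD.
by move=> /(_ measurableT _ mB); rewrite setTI.
Qed.

(* An attack: the attacked point and the start time, required to be >= 0. *)
Definition attack := (netpoint Q * R)%type.
Definition attacks : set attack := [set z | 0 <= z.2].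

Definition intercepts (alpha : R) (S : patrol) (z : attack) : Prop :=
  exists2 s, z.2 <= s <= z.2 + alpha & S s = z.1.

Local Open Scope ereal_scope.

Definition mixed_patrols : set {measure set patrol -> \bar R} :=
  [set m | m setT = 1].

Definition mixed_attacks : set {measure set attack -> \bar R} :=
  [set m | m setT = 1 /\ m (~` attacks) = 0].

Definition patrol_payoff (alpha : R) (m : set patrol -> \bar R) (z : attack) :=
  m [set S | intercepts alpha S z].

Definition attack_payoff (alpha : R) (m : set attack -> \bar R) (S : patrol) :=
  m [set z | attacks z /\ intercepts alpha S z].

Definition lower_value (alpha : R) : \bar R :=
  ereal_sup [set ereal_inf [set patrol_payoff alpha m z | z in attacks]
            | m in mixed_patrols].

Definition upper_value (alpha : R) : \bar R :=
  ereal_inf [set ereal_sup [set attack_payoff alpha m S | S in [set: patrol]]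
            | m in mixed_attacks].

Definition game_value (alpha V : R) : Prop :=
  lower_value alpha = V%:E /\ upper_value alpha = V%:E.

Definition patroller_optimal (alpha V : R)
    (m : {measure set patrol -> \bar R}) : Prop :=
  mixed_patrols m /\ forall z, attacks z -> V%:E <= patrol_payoff alpha m z.

Definition attacker_optimal (alpha V : R)
    (m : {measure set attack -> \bar R}) : Prop :=
  mixed_attacks m /\ forall S, attack_payoff alpha m S <= V%:E.

(* The law of the tour patrol of c with uniformly random starting point. *)
Definition random_tour (c : closed_walk Q) : set patrol -> \bar R :=
  image_measure (uniform_prob (@ltr01 R)) (measurable_tour_patrol c).
HB.instance Definition _ c := Measure.on (random_tour c).

Local Open Scope ring_scope.

Definition factor_weight (n : nat) (M : {set arcs Q}) : R :=
  arcs_length (~: M) / ((2 * n - 2)%:R * total_length Q).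

Lemma factor_weight_ge0 n M : 0 <= factor_weight n M.
Proof. by rewrite divr_ge0 ?mulr_ge0 ?arcs_length_ge0. Qed.

(* The mixture of the random tours [c i] of the sub-networks K_2n - F_i. For a
   1-factorization of K_2n and tours of these sub-networks, the
   weights sum to 1 when n >= 2 and all vanish when n = 1. *)
Definition complete_network_strategy (n k : nat) (F : 'I_k -> {set arcs Q})
    (c : 'I_k -> closed_walk Q) : set patrol -> \bar R :=
  fin_msum (fun i : 'I_k =>
    mscale (NngNum (factor_weight_ge0 n (F i))) (random_tour (c i))).
HB.instance Definition _ n k F c :=
  Measure.on (@complete_network_strategy n k F c).

Lemma total_length_inv_ge0 : 0 <= (total_length Q)^-1.
Proof. by rewrite invr_ge0 arcs_length_ge0. Qed.

Definition uniform_point : set (netpoint Q) -> \bar R :=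
  mscale (NngNum total_length_inv_ge0) (lam Q).
HB.instance Definition _ := Measure.on uniform_point.

Definition uniform_attack (t : R) : set attack -> \bar R :=
  image_measure uniform_point (pair2_measurable t).
HB.instance Definition _ t := Measure.on (uniform_attack t).

End Game.
Arguments uniform_attack {R} Q t.

Definition max_factor_length (R : realType) (Q : network R) k
    (F : 'I_k -> {set arcs Q}) : R :=
  \big[Num.max/0]_(i < k) arcs_length (F i).

(* Main.v *)
(* The game is solved by a pair of strategies guaranteeing V = alpha / mu.

   Attacker: a path of speed at most one covers length at most alpha during an
   interval of length alpha, so a uniform attack is intercepted with
   probability at most alpha / mu.

   Patroller: Q_i is connected of even degree 2n - 2, hence Eulerian. A tour of
   Q_i started at a uniformly random point intercepts an attack at a point of
   Q_i with probability at least alpha / lambda(Q_i), as alpha is at most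
   lambda(Q_i). Every point lies in at least 2n - 2 of the Q_i, and the weights
   are chosen so that each of these contributes alpha / ((2n - 2) mu).

   The value also requires lower value <= upper value. This is Tonelli's
   theorem for the set of pairs (patrol, attack) such that the patrol
   intercepts the attack, which is jointly measurable. *)
From HB Require Import structures.
Require Import Defs.
From mathcomp Require Import all_boot all_order all_algebra.
From mathcomp Require Import all_classical all_reals all_analysis.
From mathcomp Require Import measurable_realfun lra zify.

Set Implicit Arguments.
Unset Strict Implicit.
Unset Printing Implicit Defensive.

Import Order.TTheory GRing.Theory Num.Theory.
Import numFieldNormedType.Exports.
Local Open Scope ring_scope.

(** * Distances in a network *)

Section Metric.
Context {R : realType} (Q : network R).

Lemma path_len_arc (a : arcs Q) (s t : R) : 0 <= s <= len a ->
  0 <= t <= len a -> path_len (arc_pt a s) (arc_pt a t) `|s - t|.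
Proof.
move=> sa ta; rewrite -[`|_|]addr0; apply: path_cons => //; exact: path_nil.
Qed.

Lemma path_len_joins (a : arcs Q) (u v : node Q) : joins a u v ->
  exists l, path_len (Node u) (Node v) l.
Proof.
have l0 : path_len (Node (src a)) (Node (tgt a)) `|0 - len a|.
  rewrite -arc_pt0 -arc_pt_len.
  by apply: path_len_arc; rewrite lexx len_ge0.
case/orP => /andP[/eqP <- /eqP <-]; exists `|0 - len a| => //.
exact: path_len_sym.
Qed.

Lemma path_len_node (x : netpoint Q) :
  exists v l, path_len x (Node v) l.
Proof.
case: x => [v|a s h]; first by exists v, 0; exact: path_nil.
exists (src a), `|s - 0|; rewrite -arc_ptE -arc_pt0.
by apply: path_len_arc; rewrite ?lexx ?len_ge0//; case/andP: h => /ltW-> /ltW.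
Qed.

Lemma path_len_exists (x y : netpoint Q) : exists l, path_len x y l.
Proof.
have [u [l xu]] := path_len_node x; have [v [l' yv]] := path_len_node y.
suff [l'' uv] : exists l, path_len (Node u) (Node v) l.
  exists (l + (l'' + l')); apply: (path_len_cat xu).
  by apply: (path_len_cat uv); exact: path_len_sym.
have /connectP[p] := network_connected u v.
elim: p u {l xu} => [|w p IH] u /=; first by move=> _ ->; exists 0; exact: path_nil.
move=> /andP[/existsP[a /path_len_joins[l uw]] wp] /(IH _ wp)[l1 wv].
by exists (l + l1); exact: path_len_cat wv.
Qed.

(** The infimum of an empty set would be a default value; connectedness makes the set of path
    lengths nonempty. *)
Lemma dist_ge (x y : netpoint Q) (d : R) :
  (forall l, path_len x y l -> d <= l) -> d <= dist x y.
Proof.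
by move=> dP; apply: lb_le_inf => //; exact: path_len_exists.
Qed.

(** Increments over the segments of a path add up by the triangle inequality. Passing to the infimum
    of lengths divides by [K], hence the separate case [K = 0]. *)
Lemma lipschitz_dist (f : netpoint Q -> R) (K : R) : 0 <= K ->
  (forall (a : arcs Q) s t, 0 <= s <= len a -> 0 <= t <= len a ->
    `|f (arc_pt a s) - f (arc_pt a t)| <= K * `|s - t|) ->
  forall x y, `|f x - f y| <= K * dist x y.
Proof.
move=> K0 fK x y.
have fl l : path_len x y l -> `|f x - f y| <= K * l.
  elim=> [z|a s t z r sa ta _ IH]; first by rewrite subrr normr0 mulr0.
  rewrite mulrDr (le_trans (ler_distD (f (arc_pt a t)) _ _))//.
  by rewrite lerD// fK.
move: K0; rewrite le_eqVlt => /predU1P[K0|K0].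
  have [l /fl] := path_len_exists x y.
  by rewrite -K0 !mul0r.
rewrite mulrC -ler_pdivrMr//; apply: dist_ge => l /fl.
by rewrite ler_pdivrMr// mulrC.
Qed.

(* The largest 1-Lipschitz bump centred at the point s0 of the arc a and
   supported in a. *)
Definition tent (a : arcs Q) (s0 : R) (y : netpoint Q) : R :=
  if y is Inner b s _ then
    if b == a then Num.max 0 (Num.min s0 (len a - s0) - `|s - s0|) else 0
  else 0.

Lemma tent_arc (a b : arcs Q) (s0 s : R) : 0 < s0 < len a ->
  0 <= s <= len b -> tent a s0 (arc_pt b s) =
    if b == a then Num.max 0 (Num.min s0 (len a - s0) - `|s - s0|) else 0.
Proof.
move=> /andP[s00 s0l] /andP[s0' sl].
have [-> |s_neq0] := eqVneq s 0.
  rewrite arc_pt0/=; case: ifP => // _; apply/esym/max_idPl.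
  by rewrite sub0r normrN gtr0_norm// subr_le0 ge_min lexx.
have [-> |s_neql] := eqVneq s (len b).
  rewrite arc_pt_len/=; case: eqP => // ->; apply/esym/max_idPl.
  by rewrite gtr0_norm ?subr_gt0// subr_le0 ge_min lexx orbT.
have h : 0 < s < len b.
  by rewrite !lt_neqAle eq_sym s_neq0 s0' s_neql sl.
by rewrite (arc_ptE h).
Qed.

Lemma tent_lipschitz (a : arcs Q) (s0 : R) : 0 < s0 < len a ->
  forall x y, `|tent a s0 x - tent a s0 y| <= dist x y.
Proof.
move=> h x y; rewrite -[dist x y]mul1r; move: x y.
apply: lipschitz_dist => // b s t sb tb; rewrite !tent_arc// mul1r.
case: eqP => _; last by rewrite subrr normr0.
set m := Num.min _ _.
have -> : s - t = (s - s0) - (t - s0) by lra.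
apply: le_trans (ler_dist_dist (s - s0) (t - s0)).
move: (`|s - s0|) (`|t - s0|) => p q.
by rewrite /Num.max; do 2 case: ltP => ?; do 2 case: ger0P => ?; lra.
Qed.

(** The tent at [s0] is higher than [d] at its centre, hence still positive at [y]. This puts [y]
    inside the arc [a], where the tent formula bounds the offset. *)
Lemma dist_inner (a : arcs Q) (s0 : R) (h : 0 < s0 < len a) y (d : R) :
  dist (Inner h) y <= d -> d < s0 -> d < len a - s0 ->
  exists s (h' : 0 < s < len a), y = Inner h' /\ `|s - s0| <= d.
Proof.
move=> xy ds0 dl; have := tent_lipschitz h (Inner h) y.
move=> /ler_normlW; rewrite lerBlDr {1}/tent eqxx subrr normr0 subr0.
set m := Num.min _ _; have dm : d < m by rewrite /m lt_min ds0.
rewrite ge_max; case: y xy => [v|b s hb] xy /andP[_] /=; first by lra.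
case: eqP => [ba|_]; last by lra.
subst b => ms; exists s, hb; split=> //.
by move: ms; rewrite -/m maxC /Num.max; case: ltP; lra.
Qed.

End Metric.

(** * Measurability of interception *)

Section Barycentric.
Local Open Scope classical_set_scope.
Context {R : realType} (Q : network R).

(* The barycentric coordinates, in which the network is embedded when it has
   neither loops nor parallel arcs. *)
Definition bary (v : node Q) (y : netpoint Q) : R :=
  match y with
  | Node u => (u == v)%:R
  | Inner a s _ =>
      (src a == v)%:R * (1 - s / len a) + (tgt a == v)%:R * (s / len a)
  end.

(** The clamp in [r] mirrors the extension of [arc_pt] by its end values, so the formula holds on
    the whole real line. *)
Lemma bary_arc (v : node Q) (a : arcs Q) (s : R) :
  let r := Num.max 0 (Num.min s (len a)) / len a in
  bary v (arc_pt a s) = (src a == v)%:R * (1 - r) + (tgt a == v)%:R * r.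
Proof.
have l0 := len_gt0 a; rewrite /=.
have [s0|s0] := leP s 0.
  rewrite (_ : Num.max _ _ = 0); last first.
    by apply/max_idPl; rewrite ge_min s0.
  by rewrite /arc_pt s0/= mul0r subr0 mulr1 mulr0 addr0.
have [sl|sl] := leP (len a) s.
  rewrite (_ : Num.max _ _ = len a); last first.
    by apply/max_idPr; exact: ltW.
  rewrite divff ?gt_eqF// subrr mulr0 add0r mulr1 /arc_pt (lt_geF s0).
  by case: pselect => // h; exfalso; move: h; rewrite s0/= ltNge sl.
rewrite (_ : Num.max _ _ = s); last by apply/max_idPr; exact: ltW.
have h : 0 < s < len a by rewrite s0.
by rewrite (arc_ptE h).
Qed.

(** The sigma-algebra of points is final for the maps [arc_pt a], so only the compositions with them
    need checking. *)
Lemma measurable_bary (v : node Q) : measurable_fun [set: netpoint Q] (bary v).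
Proof.
suff mf a : measurable_fun [set: R] (bary v \o arc_pt a).
  move=> _ B mB; rewrite setTI.
  suff : measurable_points (bary v @^-1` B) by [].
  by move=> a; rewrite -comp_preimage -[X in measurable X]setTI; exact: mf.
rewrite (_ : bary v \o arc_pt a = fun s =>
    (src a == v)%:R * (1 - Num.max 0 (Num.min s (len a)) / len a) +
    (tgt a == v)%:R * (Num.max 0 (Num.min s (len a)) / len a)); last first.
  by apply/funext => s /=; rewrite bary_arc.
have mr : measurable_fun [set: R]
    (fun s => Num.max 0 (Num.min s (len a)) / len a).
  apply: measurable_funM => //.
  apply: measurable_maxr => //.
  exact: measurable_minr.
apply: measurable_funD; apply: measurable_funM => //.
exact: measurable_funB.
Qed.

(** The l1 distance in barycentric coordinates. It replaces [dist] in the measurability argument,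
    being a finite expression in measurable functions. *)
Definition bary_dist (x y : netpoint Q) : R := \sum_v `|bary v x - bary v y|.

Lemma bary_dist_ge0 x y : 0 <= bary_dist x y.
Proof. exact: sumr_ge0. Qed.

Lemma bary_distxx x : bary_dist x x = 0.
Proof. by rewrite /bary_dist big1// => v _; rewrite subrr normr0. Qed.

(** Along an arc [a] a coordinate changes at rate at most [1 / len a], and the sum over all arcs
    dominates each of these rates. *)
Lemma bary_lipschitz (v : node Q) (x y : netpoint Q) :
  `|bary v x - bary v y| <= (\sum_(a : arcs Q) (len a)^-1) * dist x y.
Proof.
move: x y; apply: lipschitz_dist.
  by apply: sumr_ge0 => a _; rewrite invr_ge0 len_ge0.
move=> a s t /andP[s0 sl] /andP[t0 tl]; rewrite !bary_arc.
rewrite !(min_idPl _)// !(max_idPr _)//.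
have -> : forall p q : R, p * (1 - s / len a) + q * (s / len a) -
    (p * (1 - t / len a) + q * (t / len a)) = (q - p) * ((s - t) / len a).
  by move=> p q; lra.
rewrite normrM normrM [X in _ <= X]mulrC mulrA normfV (gtr0_norm (len_gt0 a)).
apply: ler_pM => //.
- by rewrite invr_ge0 len_ge0.
- rewrite -[leRHS]mul1r ler_wpM2r//.
  by case: (tgt a == v); case: (src a == v);
    rewrite ?subrr ?normr0 ?subr0 ?sub0r ?normrN ?normr1.
- rewrite (bigD1 a)//= lerDl.
  by apply: sumr_ge0 => b _; rewrite invr_ge0 len_ge0.
Qed.

Definition bary_const : R := #|node Q|%:R * \sum_(a : arcs Q) (len a)^-1.

Lemma bary_const_ge0 : 0 <= bary_const.
Proof.
by rewrite mulr_ge0// sumr_ge0// => a _; rewrite invr_ge0 len_ge0.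
Qed.

Lemma bary_dist_lipschitz (x y z : netpoint Q) :
  `|bary_dist x y - bary_dist x z| <= bary_const * dist y z.
Proof.
rewrite /bary_dist -sumrB (le_trans (ler_norm_sum _ _ _))//.
rewrite /bary_const -mulrA mulr_natl -sumr_const.
apply: ler_sum => v _; apply: le_trans (bary_lipschitz v y z).
apply: le_trans (ler_dist_dist _ _) _.
rewrite distrC (_ : _ - _ = bary v y - bary v z)//; lra.
Qed.

Hypothesis Q_complete : complete_network Q.

(** A node has a coordinate equal to 1, while an inner point of a loopless arc has exactly two
    nonzero coordinates, both below 1. These mark the ends of the arc, which determine it, and their
    values give the position on it. *)
Lemma bary_inj (x y : netpoint Q) : (forall v, bary v x = bary v y) -> x = y.
Proof.
have [noloop simple] := Q_complete.
have NI (u : node Q) a s (h : 0 < s < len a) :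
    ~ (forall v, bary v (Node u) = bary v (Inner h)).
  move=> /(_ u)/=; rewrite eqxx.
  have /andP[s0 sl] := h; have l0 := len_gt0 a.
  have r0 : 0 < s / len a by rewrite divr_gt0.
  have r1 : s / len a < 1 by rewrite ltr_pdivrMr// mul1r.
  have /eqP := noloop a.
  by case: (src a =P u) => [->|_]; case: (tgt a =P u) => [->|_] //= *; lra.
case: x y => [u|a s h] [w|b t h'].
- by move=> /(_ u)/=; rewrite eqxx; case: eqP => [->//|_ /eqP]; rewrite oner_eq0.
- by move=> /NI.
- by move=> xy; exfalso; apply: (@NI w a s h) => v; rewrite xy.
move=> xy.
have r0 (c : arcs Q) (r : R) : 0 < r < len c -> 0 < r / len c < 1.
  by move=> /andP[? ?]; rewrite divr_gt0 ?len_gt0//= ltr_pdivrMr ?len_gt0// mul1r.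
have /andP[sa sb] := r0 a s h; have /andP[ta tb] := r0 b t h'.
have ba : a = b.
  (* The coordinates at both ends of [a] are positive, so both ends of [a] are ends of [b]. *)
  have jab : joins b (src a) (tgt a).
    have := xy (src a); have := xy (tgt a).
    rewrite /joins /= !eqxx [tgt a == src a]eq_sym (negbTE (noloop a)).
    have nb v : (src b == v) && (tgt b == v) = false.
      by apply/negP => /andP[/eqP e /eqP e']; have := noloop b; rewrite e e' eqxx.
    have na v : (v == src a) && (v == tgt a) = false.
      by apply/negP => /andP[/eqP e /eqP e']; have := noloop a; rewrite -e -e' eqxx.
    move: (nb (src a)) (nb (tgt a)) (na (src b)) (na (tgt b)).
    by do 4 case: (_ == _) => //=; rewrite ?mul0r ?mul1r; lra.
  have /eqP/cards1P[c cE] := simple _ _ (noloop a).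
  have : a \in [set c]%SET by rewrite -cE inE /joins !eqxx.
  have : b \in [set c]%SET by rewrite -cE inE.
  by rewrite !inE => /eqP -> /eqP ->.
subst b; suff st : s = t by subst t; rewrite (bool_irrelevance h h').
have := xy (src a); rewrite /= eqxx eq_sym (negbTE (noloop a)) !mul0r !mul1r.
rewrite !addr0 => e; have {}e : s / len a = t / len a by lra.
by apply: (mulIf (invr_neq0 (lt0r_neq0 (len_gt0 a)))).
Qed.

Lemma bary_dist_eq0 (x y : netpoint Q) : bary_dist x y = 0 -> x = y.
Proof.
move=> xy; apply: bary_inj => v; apply/eqP; rewrite -subr_eq0 -normr_eq0.
have /psumr_eq0P : forall w, true -> 0 <= `|bary w x - bary w y| by [].
by move=> /(_ xy) /(_ v isT) ->.
Qed.

End Barycentric.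

Section Measurability.
Local Open Scope classical_set_scope.
Context {R : realType} (Q : network R).
Hypothesis Q_complete : complete_network Q.

Lemma lipschitz_continuous (f : R -> R) (K : R) : 0 <= K ->
  (forall x y, `|f x - f y| <= K * `|x - y|) -> continuous f.
Proof.
move=> K0 fK x; apply/cvgrPdist_lt => e e0.
have K1 : 0 < K + 1 by lra.
have eK : 0 < e / (K + 1) by rewrite divr_gt0.
apply: filterS (nbhsx_ballx x _ eK) => y /= xy; apply: (le_lt_trans (fK x y)).
apply: (@le_lt_trans _ _ ((K + 1) * `|x - y|)); first by rewrite ler_wpM2r// lerDl.
by rewrite mulrC -ltr_pdivlMr.
Qed.

(* A description of interception by countably many conditions, each involving
   the patrol at a single rational time; compactness makes it sufficient. *)
Lemma interceptsP (alpha : R) (S : patrol Q) x (t : R) : 0 <= t -> 0 <= alpha ->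
  intercepts alpha S (x, t) <->
  forall k : nat, exists q : rat,
    [/\ 0 <= ratr q :> R, t - k.+1%:R^-1 < ratr q < t + alpha + k.+1%:R^-1 &
        bary_dist x (S (ratr q)) < k.+1%:R^-1].
Proof.
move=> t0 a0; have C0 := bary_const_ge0 Q; split=> [[s]|hits] /=.
  move=> /andP[ts sta] Ss k; set d := k.+1%:R^-1.
  have d0 : 0 < d by rewrite /d invr_gt0.
  have C1 : 0 < bary_const Q + 1 by lra.
  (* Dividing by the constant plus one gives both [e <= d] and [bary_const Q * e < d]. *)
  pose e := d / (bary_const Q + 1).
  have e0 : 0 < e by rewrite divr_gt0.
  have ed : e <= d by rewrite ler_pdivrMr// ler_peMr ?(ltW d0)//; lra.
  have /rat_in_itvoo[q] : s < s + e by lra.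
  rewrite in_itv/= => /andP[sq qse]; exists q; split; [lra|lra|].
  have := bary_dist_lipschitz x (S s) (S (ratr q)).
  rewrite Ss bary_distxx sub0r normrN => /ler_normlW/le_lt_trans; apply.
  apply: (@le_lt_trans _ _ (bary_const Q * e)); last first.
    by rewrite /e mulrCA gtr_pMr// ltr_pdivrMr// mul1r ltrDl.
  rewrite ler_wpM2l// -Ss (le_trans (patrol_speed S _ _))//; [lra..|].
  by rewrite ler_norml; lra.
(* Patrols are Lipschitz only at times [>= 0]; clamping makes [f] continuous on the whole line, so
   it attains its minimum on the attack interval. The conditions force this minimum to be 0. *)
pose f s := bary_dist x (S (Num.max 0 s)).
have fK s s' : `|f s - f s'| <= bary_const Q * `|s - s'|.
  apply: (le_trans (bary_dist_lipschitz _ _ _)); rewrite ler_wpM2l//.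
  apply: (le_trans (patrol_speed S _ _)); rewrite ?le_max ?lexx//.
  by rewrite /Num.max; do 2 case: ltP => ?; repeat case: ger0P => ?; lra.
have [|s sta smin] := @EVT_min R f t (t + alpha) (ltac:(lra)).
  by apply: continuous_subspaceT; exact: lipschitz_continuous fK.
exists s; first by rewrite in_itv in sta.
move: sta; rewrite in_itv/= => /andP[ts sta].
have -> : s = Num.max 0 s by apply/esym/max_idPr; lra.
apply/esym/bary_dist_eq0 => //; rewrite -/(f s).
apply/eqP; rewrite eq_le bary_dist_ge0 andbT.
apply/ler_addgt0Pr => e e0; rewrite add0r.
have [k] : exists k : nat, (bary_const Q + 1) / e < k.+1%:R.
  exists (Num.truncn ((bary_const Q + 1) / e)).
  exact: truncnS_gt.
rewrite ltr_pdivrMr// mulrC -ltr_pdivrMr// => ke.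
have [q [q0 qt fq]] := hits k; set d := k.+1%:R^-1 in ke qt fq.
have d0 : 0 < d by rewrite /d invr_gt0.
(* [q'] is the point of the attack interval nearest to [q]. Moving there costs at most
   [bary_const Q * d], so [f q'] is below [(bary_const Q + 1) * d < e]. *)
have [q' q't qq'] : exists2 q' : R, q' \in `[t, t + alpha]%R & `|q' - ratr q| <= d.
  have [qt'|tq] := ltP (ratr q) t.
    by exists t; rewrite ?in_itv/= ?ler_norml; lra.
  have [qt'|tq'] := ltP (t + alpha) (ratr q).
    by exists (t + alpha); rewrite ?in_itv/= ?ler_norml; lra.
  by exists (ratr q); rewrite ?in_itv/= ?ler_norml; lra.
apply: (le_trans (smin _ q't)).
have fqE : f (ratr q) = bary_dist x (S (ratr q)) by rewrite /f (max_idPr _).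
have := fK q' (ratr q) => /ler_normlW fqq'.
have : bary_const Q * `|q' - ratr q| <= bary_const Q * d by rewrite ler_wpM2l.
rewrite mulrDl mul1r -/d in ke.
lra.
Qed.

Definition interceptions (alpha : R) : set (patrol Q * attack Q) :=
  [set p | attacks p.2 /\ intercepts alpha p.1 p.2].

Lemma measurable_patrol_pos (s : R) : 0 <= s ->
  measurable_fun [set: patrol Q] (fun S : patrol Q => S s).
Proof.
move=> s0 _ B mB; rewrite setTI; apply: sub_sigma_algebra.
by exists s, B.
Qed.

Lemma measurable_interceptions (alpha : R) : 0 <= alpha ->
  measurable (interceptions alpha).
Proof.
move=> a0.
pose A : set (patrol Q * attack Q) := [set p | 0 <= p.2.2].
(* The sigma-algebra of patrols is generated by positions at times [>= 0], so negative rationals are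
   sent to the empty set. *)
pose G k q : set (patrol Q * attack Q) := if (0 <= ratr q :> R) then
   [set p : patrol Q * attack Q | ((p.2.2 - k.+1%:R^-1 < ratr q) &&
            (ratr q < p.2.2 + alpha + k.+1%:R^-1)) &&
            (bary_dist p.2.1 (p.1 (ratr q)) < k.+1%:R^-1)] else set0.
have -> : interceptions alpha = A `&` \bigcap_k \bigcup_q G k q.
  apply/seteqP; split=> -[S [x t]].
    move=> [/= t0 /(interceptsP _ _ t0 a0) h]; split=> // k _.
    have [q [q0 qt qx]] := h k; exists q => //.
    by rewrite /G q0/= qx andbT.
  move=> [/= t0 h]; split => //=; apply/(interceptsP _ _ t0 a0) => k.
  have [q _] := h k I; rewrite /G; case: ifPn => [q0 /= /andP[qt qx]|_ []].
  by exists q.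
have m2 : measurable_fun [set: patrol Q * attack Q] (fun p => p.2.2).
  exact: (measurableT_comp measurable_snd measurable_snd).
have mset (b : patrol Q * attack Q -> bool) : measurable_fun setT b ->
    measurable [set p | b p].
  by move=> mb; rewrite -[X in measurable X]setTI; exact: (mb measurableT [set true]).
apply: measurableI.
  by apply: (mset (fun p => 0 <= p.2.2)); exact: measurable_fun_ler.
apply: bigcapT_measurable => k; apply: bigcupT_measurable_rat => q.
rewrite /G; case: ifPn => // q0.
apply: (mset (fun p => _ && _)); apply: measurable_and; first apply: measurable_and.
- apply: measurable_fun_ltr => //; exact: measurable_funB.
- apply: measurable_fun_ltr => //; apply: measurable_funD => //.
  exact: measurable_funD.
- apply: measurable_fun_ltr => //; apply: measurable_sum => v.
  apply: measurableT_comp => //; apply: measurable_funB.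
    apply: measurableT_comp; first exact: measurable_bary.
    exact: (measurableT_comp measurable_fst measurable_snd).
  apply: measurableT_comp; first exact: measurable_bary.
  exact: (measurableT_comp (measurable_patrol_pos q0) measurable_fst).
Qed.

End Measurability.

(** * Weak duality *)

Section UnitMass.
Local Open Scope classical_set_scope.
Local Open Scope ereal_scope.
Context d (T : measurableType d) (R : realType) (m : {measure set T -> \bar R}).

(** A copy of [m] indexed by the proof that its mass is 1, so that it can be declared a probability
    and Tonelli applies. *)
Definition unit_mass (_ : m [set: T] = 1) : set T -> \bar R := m.

Hypothesis m1 : m [set: T] = 1.

HB.instance Definition _ := Measure.on (unit_mass m1).
HB.instance Definition _ :=
  @Measure_isProbability.Build _ _ R (unit_mass m1) m1.

End UnitMass.

Section WeakDuality.
Local Open Scope classical_set_scope.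
Local Open Scope ereal_scope.
Context {R : realType} (Q : network R).
Hypothesis Q_complete : complete_network Q.

(** The joint probability of [E] is an average of patrol payoffs, hence at least the infimum, and an
    average of attack payoffs, hence at most the supremum. *)
Lemma weak_duality (alpha : R) (m : {measure set patrol Q -> \bar R})
    (q : {measure set attack Q -> \bar R}) : (0 <= alpha)%R ->
  mixed_patrols m -> mixed_attacks q ->
  ereal_inf [set patrol_payoff alpha m z | z in attacks (Q := Q)] <=
  ereal_sup [set attack_payoff alpha q S | S in [set: patrol Q]].
Proof.
move=> a0 m1 [q1 qA]; have mE := measurable_interceptions Q_complete a0.
set E := interceptions alpha in mE.
pose pm : probability (patrol Q) R :=
  unit_mass m1.
pose pq : probability (attack Q) R :=
  unit_mass q1.
have := indic_fubini_tonelli pm pq mE.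
rewrite indic_fubini_tonelli_FE// indic_fubini_tonelli_GE//= => fub.
set I := ereal_inf _; set U := ereal_sup _.
have mA : measurable (attacks (Q := Q)).
  have mb : measurable_fun [set: attack Q] (fun z : attack Q => 0 <= z.2)%R.
    by apply: measurable_fun_ler => //; exact: measurable_snd.
  by rewrite -[X in measurable X]setTI; exact: (mb measurableT [set true]).
have I0 : 0 <= I by apply/le_ereal_inf_tmp => _ [z _ <-]; exact: measure_ge0.
have qA1 : q (attacks (Q := Q)) = 1.
  rewrite -q1 -(setvU (attacks (Q:=Q))) measureU ?setICl//.
    by rewrite -[LHS]add0e; congr (_ + _).
  exact: measurableC.
have U0 : 0 <= U.
  apply: le_trans (measure_ge0 q [set z | attacks z /\ intercepts alpha point z]) _.
  by apply: ereal_sup_ubound; exists point.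
apply: (@le_trans _ _ (\int[pq]_z (pm \o ysection E) z)).
  (* The infimum bounds payoffs only at start times [>= 0]; [attacks] carries the whole mass of [q],
     so the constant [I] still integrates to [I] over it. *)
  apply: (@le_trans _ _ (\int[q]_(z in attacks (Q := Q)) cst I z)).
    by rewrite integral_cst//= qA1 mule1.
  apply: (@le_trans _ _ (\int[pq]_(z in attacks (Q := Q)) (pm \o ysection E) z)).
    apply: ge0_le_integral => //.
    - by apply/measurable_funTS; exact: measurable_fun_ysection.
    - move=> z zA; apply: ereal_inf_lbound; exists z => //.
      rewrite /patrol_payoff /=; congr (m _); apply/seteqP; split=> S /=.
        by move=> Sz; rewrite /ysection/= inE.
      by rewrite /ysection/= inE => -[].
  apply: ge0_subset_integral => //.
  exact: measurable_fun_ysection.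
rewrite -fub; apply: (@le_trans _ _ (\int[m]_z cst U z)); last first.
  by rewrite integral_cst//= m1 mule1.
apply: ge0_le_integral => //.
- exact: measurable_fun_xsection.
- move=> S _; apply: ereal_sup_ubound; exists S => //.
  rewrite /attack_payoff; congr (q _); apply/seteqP; split=> z /=.
    by move=> [? ?]; rewrite /xsection/= inE.
  by rewrite /xsection/= inE => -[].
Qed.

Lemma game_value_optimal (alpha V : R) (m : {measure set patrol Q -> \bar R})
    (q : {measure set attack Q -> \bar R}) : (0 <= alpha)%R ->
  patroller_optimal alpha V m -> attacker_optimal alpha V q ->
  game_value Q alpha V.
Proof.
move=> a0 [m1 mV] [q1 qV].
have lu : lower_value Q alpha <= upper_value Q alpha.
  apply/ge_ereal_sup => _ [m' m'1 <-]; apply/le_ereal_inf_tmp => _ [q' q'1 <-].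
  exact: weak_duality.
have Vl : V%:E <= lower_value Q alpha.
  apply: le_trans (ereal_sup_ubound _); last by exists m.
  by apply/le_ereal_inf_tmp => _ [z za <-]; exact: mV.
have uV : upper_value Q alpha <= V%:E.
  apply: le_trans (ereal_inf_lbound _) _; first by exists q.
  by apply/ge_ereal_sup => _ [S _ <-]; exact: qV.
by split; apply/le_anti/andP; split=> //; [exact: le_trans uV|exact: le_trans lu].
Qed.

End WeakDuality.

(** * The uniform attack *)

Section UniformAttack.
Local Open Scope classical_set_scope.
Context {R : realType} (Q : network R).

Definition visited (alpha : R) (S : patrol Q) (t : R) : set (netpoint Q) :=
  [set x | intercepts alpha S (x, t)].

Section Cover.
Variables (alpha : R) (S : patrol Q) (t e : R).
Hypotheses (t_ge0 : 0 <= t) (e_gt0 : 0 < e).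

(** The midpoint of the [i]-th slot of length [e] after [t]: every time of the slot is within
    [e / 2] of it. *)
Definition sample_time (i : nat) : R := t + (i%:R + 2^-1) * e.

(** Empty when the sampled position is a node or lies on another arc: the points of [a] visited in
    such a slot are within [e] of an end of [a]. *)
Definition sample_ball (a : arcs Q) (i : nat) : set R :=
  if S (sample_time i) is Inner b p _ then
    if b == a then `[p - e / 2, p + e / 2] else set0
  else set0.

Lemma measurable_sample_ball a i : measurable (sample_ball a i).
Proof. by rewrite /sample_ball; case: (S _) => // b p _; case: ifP. Qed.

(** A sampled position is inside at most one arc, so one sample costs [e] over the whole network
    rather than per arc. *)
Lemma sum_sample_ball i :
  (\sum_(a : arcs Q) lebesgue_measure (sample_ball a i) <= e%:E)%E.
Proof.
rewrite /sample_ball; case: (S _) => [v|b p _].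
  by rewrite big1 ?lee_fin ?ltW// => a _; rewrite measure0.
rewrite (bigD1 b)//= eqxx big1 ?adde0; last first.
  by move=> a; rewrite eq_sym => /negbTE ->; rewrite measure0.
rewrite lebesgue_measure_itv/= lte_fin; case: ifP => _.
  by rewrite -EFinD lee_fin; lra.
by rewrite lee_fin ltW.
Qed.

(* Away from the ends of the arc, the part of the patrol within time e/2 of a
   sample time lies in a ball of radius e/2 which is an interval of the arc. *)
Lemma visited_cover (N : nat) a : alpha = N%:R * e ->
  (arc_pt a @^-1` visited alpha S t) `&` `]0, len a[ `<=`
  `]0, e] `|` (`[len a - e, len a[ `|`
    \big[setU/set0]_(i < N.+1) sample_ball a i).
Proof.
move=> alphaE s [/= [s' /= /andP[ts' s't] Ss']]; rewrite in_itv/= => sl.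
have [se|es] := leP s e; first by left; rewrite /= in_itv/=; lra.
have [ls|sle] := leP (len a - e) s.
  by right; left; rewrite /= in_itv/=; lra.
right; right; rewrite -bigcup_mkord.
(* The slot containing the visit time; it is [N] when [s' = t + alpha], hence the [N.+1] balls. *)
pose i := Num.truncn ((s' - t) / e).
have s'te0 : 0 <= (s' - t) / e by rewrite divr_ge0 ?(ltW e_gt0)// subr_ge0.
have /andP[] := truncn_itv s'te0; rewrite -/i.
rewrite ler_pdivlMr// ltr_pdivrMr// -natr1 mulrDl mul1r => ie ie1.
exists i.
  rewrite /= ltnS -(ler_nat R) -(ler_pM2r e_gt0) -alphaE.
  by apply: (le_trans ie); lra.
have ti0 : 0 <= sample_time i.
  by rewrite /sample_time addr_ge0// mulr_ge0 ?ltW// addr_ge0// invr_ge0.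
have /dist_inner : dist (Inner sl) (S (sample_time i)) <= e / 2.
  have := patrol_speed S (le_trans t_ge0 ts') ti0.
  rewrite Ss' (arc_ptE sl) => /le_trans; apply.
  by rewrite ler_norml /sample_time; lra.
move=> [||p [h' [Sp ps]]]; [lra|lra|].
rewrite /sample_ball Sp eqxx /= in_itv/=.
by move: ps; rewrite ler_norml; lra.
Qed.

Lemma lam_visited_sample (N : nat) : alpha = N%:R * e ->
  measurable (visited alpha S t) ->
  (lam Q (visited alpha S t) <= (alpha + (#|arcs Q|.*2.+1)%:R * e)%:E)%E.
Proof.
move=> alphaE mV; rewrite /lam /fin_msum /image_measure /pushforward /mrestr.
pose mu := @lebesgue_measure R.
have mS a : measurable (\big[setU/set0]_(i < N.+1) sample_ball a i).
  by apply: bigsetU_measurable => i _; exact: measurable_sample_ball.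
have el (a b : R) :
    (mu `]a, (a + e)%R] <= e%:E /\ mu `[(b - e)%R, b[ <= e%:E)%E.
  rewrite /mu !lebesgue_measure_itv/= !lte_fin.
  by split; case: ifP => _; rewrite -?EFinD lee_fin ?(ltW e_gt0)//; lra.
apply: (@le_trans _ _ (\sum_(a : arcs Q)
    ((e + e)%:E + \sum_(i < N.+1) mu (sample_ball a i)))%E).
  apply: lee_sum => a _.
  have mA : measurable (arc_pt a @^-1` visited alpha S t `&` `]0, len a[).
    by apply: measurableI => //; exact: mV.
  have mB : measurable (`]0, e] `|` (`[len a - e, len a[ `|`
      \big[setU/set0]_(i < N.+1) sample_ball a i)).
    by do 2 apply: measurableU => //; exact: mS.
  apply: (le_trans (le_measure mu (mem_set mA) (mem_set mB)
    (visited_cover (a := a) alphaE))).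
  have mC : measurable (`[len a - e, len a[ `|`
      \big[setU/set0]_(i < N.+1) sample_ball a i) by exact: measurableU.
  apply: le_trans (measureU2 mu (measurable_itv _) mC) _.
  rewrite EFinD -addeA; apply: leeD; first by have [] := el 0 0; rewrite add0r.
  apply: le_trans (measureU2 mu (measurable_itv _) (mS a)) _.
  apply: leeD; first by have [] := el 0 (len a).
  by apply: le_mu_bigsetU => i _; exact: measurable_sample_ball.
(* Summing over arcs first bounds each sample by [e]. The error term collects [2 * e] for the ends
   of each arc and [e] for the extra sample. *)
rewrite big_split/= exchange_big/= sumEFin sumr_const.
apply: (@le_trans _ _ (((e + e) *+ #|arcs Q|)%:E + \sum_(i < N.+1) e%:E)%E).
  by rewrite leeD2l//; apply: lee_sum => i _; exact: sum_sample_ball.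
rewrite sumEFin sumr_const card_ord -EFinD lee_fin alphaE.
rewrite -[e *+ _]mulr_natl -[_ *+ #|_|]mulr_natl -!natr1 -addnn natrD; lra.
Qed.

End Cover.

(** The error in [lam_visited_sample] is a constant times the slot length [alpha / N.+1], so
    refining the slots makes it arbitrarily small. *)
Lemma lam_visited (alpha : R) (S : patrol Q) (t : R) : 0 <= t -> 0 < alpha ->
  measurable (visited alpha S t) -> (lam Q (visited alpha S t) <= alpha%:E)%E.
Proof.
move=> t0 a0 mV; apply/lee_addgt0Pr => d d0.
pose c : R := (#|arcs Q|.*2.+1)%:R.
have c0 : 0 < c by [].
pose N := Num.truncn (c * alpha / d).
have := truncnS_gt (c * alpha / d); rewrite -/N ltr_pdivrMr// => Nd.
have N0 : 0 < N.+1%:R :> R by [].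
have e0 : 0 < alpha / N.+1%:R by rewrite divr_gt0.
apply: le_trans (lam_visited_sample t0 e0 (N := N.+1) _ mV) _.
  by rewrite mulrC divfK// gt_eqF.
by rewrite lee_fin lerD2l mulrA ler_pdivrMr// mulrC [d * _]mulrC ltW// mulrC.
Qed.

Hypothesis Q_complete : complete_network Q.

Lemma measurable_visited (alpha : R) (S : patrol Q) (t : R) : 0 <= t ->
  0 <= alpha -> measurable (visited alpha S t).
Proof.
move=> t0 a0.
have := measurable_xsection S (measurable_interceptions Q_complete a0).
move=> /(pair2_measurable t measurableT); rewrite setTI.
set E := (X in measurable X -> _); suff -> : visited alpha S t = E by [].
by apply/seteqP; split=> x; rewrite /E/= /xsection/= inE => // -[].
Qed.

Lemma uniform_attack_optimal (alpha t : R) : 0 < total_length Q ->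
  0 < alpha -> 0 <= t ->
  attacker_optimal alpha (alpha / total_length Q) (uniform_attack Q t).
Proof.
move=> mu0 a0 t0.
have uE (A : set (attack Q)) : uniform_attack Q t A =
  ((total_length Q)^-1%:E * lam Q [set x | A (x, t)])%E by [].
split; first split.
- rewrite /= uE (_ : mkset _ = subnetwork [set: arcs Q]%SET).
    by rewrite lamE -EFinM mulVf// gt_eqF.
  by apply/seteqP; split=> // -[v|a s h] _ //=; rewrite inE.
- rewrite /= uE (_ : mkset _ = set0) ?measure0 ?mule0//.
  by rewrite -subset0 => x; rewrite /attacks /=.
move=> S; rewrite /attack_payoff /= uE.
set A := (X in lam Q X); have -> : A = visited alpha S t.
  by apply/seteqP; split=> x; rewrite /A /visited /attacks/= => // -[].
rewrite mulrC EFinM; apply: lee_wpmul2l.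
  by rewrite lee_fin invr_ge0 ltW.
by apply: lam_visited => //; apply: measurable_visited => //; exact: ltW.
Qed.

End UniformAttack.

(** * The random tours *)

Section Patroller.
Local Open Scope classical_set_scope.
Context {R : realType} (Q : network R).

Lemma tour_pos_walk (c : closed_walk Q) (r : R) : 0 <= r < walk_length c ->
  tour_pos c r = walk_pos (Node (tour_base c)) c r.
Proof.
move=> /andP[r0 rL]; have L0 : 0 < walk_length c by exact: le_lt_trans rL.
rewrite /tour_pos /modr (_ : Num.floor _ = 0) ?mulr0 ?subr0//.
apply: floor_def; rewrite add0r divr_ge0 ?(ltW L0)//=.
by rewrite ltr_pdivrMr// mul1r.
Qed.

Lemma tour_pos_periodic (c : closed_walk Q) (r : R) (k : int) :
  0 < walk_length c -> tour_pos c (r + walk_length c * k%:~R) = tour_pos c r.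
Proof.
move=> L0; rewrite /tour_pos /modr; congr walk_pos.
rewrite mulrDl mulrAC divff ?gt_eqF// mul1r floorDrz ?intr_int// intrD intrKfloor.
by lra.
Qed.

Lemma walk_pos_visits (u : node Q) (c : seq (dart Q)) e (s : R) :
  dart_chain u c -> e \in c -> 0 <= s <= len e.1 ->
  exists2 r, 0 <= r <= walk_length c & walk_pos (Node u) c r = dart_pt e s.
Proof.
elim: c u => [//|f c IH] u; rewrite dart_chain_cons => /andP[_ cc].
have wl : walk_length (f :: c) = len f.1 + walk_length c.
  by rewrite /walk_length big_cons.
have c0 := walk_length_ge0 c; rewrite wl.
rewrite inE => /predU1P[->|ec] /andP[s0 sl] /=.
  by exists s; [lra|rewrite sl].
have [|r /andP[r0 rc] <-] := IH _ cc ec; first by rewrite s0.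
(* At a junction [walk_pos] still evaluates the earlier dart, so time 0 of the remaining walk is
   read as the end of [f]. *)
move: r0; rewrite le_eqVlt => /predU1P[<-|r0].
  exists (len f.1); first by rewrite len_ge0/=; lra.
  by rewrite lexx walk_pos0// dart_pt_len.
exists (len f.1 + r); first by have := len_ge0 f.1; lra.
by rewrite leNgt ltrDl r0/= addrAC subrr add0r.
Qed.

Lemma tour_visits (c : closed_walk Q) a (s : R) : a \in map fst (darts c) ->
  0 <= s <= len a -> exists r, tour_pos c r = arc_pt a s.
Proof.
move=> /mapP[[a' b] ec /= aa'] sa; subst a'.
pose s' := if b then s else len a - s.
have s'a : 0 <= s' <= len a by rewrite /s'; case: b {ec s'}; lra.
have [r /andP[r0]] := walk_pos_visits (tour_chain c) ec s'a.
have -> : dart_pt (a, b) s' = arc_pt a s.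
  by rewrite /dart_pt /s' /=; case: b {ec s' s'a} => //; rewrite subKr.
rewrite le_eqVlt => /predU1P[->|rL] <-; last first.
  by exists r; rewrite tour_pos_walk// r0.
(* The final time [walk_length c] is not a value of [modr]; the tour being closed, time 0 gives the
   same point. *)
exists 0; rewrite /tour_pos /modr mul0r floor0 mulr0 subr0.
by rewrite walk_pos0 ?tour_chain// tour_end.
Qed.

Lemma point_on_arc (x : netpoint Q) : (forall v : node Q, exists a, incident v a) ->
  exists a s, 0 <= s <= len a /\ x = arc_pt a s.
Proof.
move=> deg; case: x => [v|a s h].
  have [a /orP[/eqP <-|/eqP <-]] := deg v.
    by exists a, 0; rewrite arc_pt0 lexx len_ge0.
  by exists a, (len a); rewrite arc_pt_len lexx len_ge0.
by exists a, s; rewrite arc_ptE; split=> //; have /andP[/ltW -> /ltW ->] := h.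
Qed.

Lemma uniform_prob_lebesgue (B : set R) : measurable B ->
  B `<=` `[0, 1] -> uniform_prob (@ltr01 R) B = lebesgue_measure B.
Proof.
move=> mB B01; rewrite /uniform_prob.
rewrite (eq_integral (cst 1%E)); first by rewrite integral_cst// mul1e.
move=> u; rewrite inE => /B01; rewrite /uniform_pdf /= in_itv/= => ->.
by rewrite subr0 invr1.
Qed.

(* An arc of length beta of the circle R/Z has mass at least beta, also when it
   wraps around 0. *)
Lemma uniform_prob_arc (theta beta : R) (A : set R) : 0 <= beta <= 1 ->
  measurable A ->
  (forall u (k : int), 0 <= u <= 1 ->
    theta <= u + k%:~R <= theta + beta -> A u) ->
  (beta%:E <= uniform_prob (@ltr01 R) A)%E.
Proof.
move=> /andP[b0 b1] mA hA.
pose k := Num.floor theta; pose th := theta - k%:~R.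
have /andP[th0 th1] : 0 <= th < 1.
  by have := floor_itv theta; rewrite -/k /th intrD; lra.
have thE : theta = th + k%:~R by rewrite /th subrK.
move: th thE th0 th1 => th thE th0 th1.
have leA (B : set R) : measurable B -> B `<=` `[0, 1] -> B `<=` A ->
    (lebesgue_measure B <= uniform_prob (@ltr01 R) A)%E.
  move=> mB B01 BA; rewrite -uniform_prob_lebesgue//.
  by apply: le_measure; rewrite ?inE.
have [thb|thb] := leP (th + beta) 1.
  have := leA `[th, th + beta]; rewrite lebesgue_measure_itv/= lte_fin ltrDl.
  have -> : (if (0 < beta)%R then (th + beta)%:E - th%:E else 0)%E = beta%:E.
    have [_|b0'] := ltP 0 beta; first by rewrite -EFinB addrAC subrr add0r.
    by congr EFin; apply/le_anti; rewrite b0.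
  apply=> // u /=; rewrite in_itv/= => ub; first by rewrite in_itv/=; lra.
  by apply: (hA u k); lra.
(* The arc wraps around: its first piece is reached one turn later, with [k + 1]. That piece is
   half-open so that the two stay disjoint when [beta = 1]. *)
have := leA (`[0, th + beta - 1[ `|` `[th, 1]).
rewrite measureU//=; last first.
  by apply/seteqP; split=> // u [] /=; rewrite !in_itv/= => /andP[? ?] /andP[? ?]; lra.
rewrite !lebesgue_measure_itv/= !lte_fin th1.
have -> : 0 < th + beta - 1 by lra.
rewrite -!EFinB -EFinD (_ : th + beta - 1 - 0 + (1 - th) = beta); last by lra.
apply; first exact: measurableU.
  by move=> u [] /=; rewrite !in_itv/= => /andP[? ?]; lra.
move=> u [] /=; rewrite in_itv/= => ub.
  by apply: (hA u (k + 1)); rewrite ?intrD; lra.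
by apply: (hA u k); lra.
Qed.

Hypothesis Q_complete : complete_network Q.

(** Started at parameter [u], the tour is at [x] at time [s] if [L * u + s] equals [r] modulo [L].
    As [s] runs over the attack interval, these [u] fill an arc of length [alpha / L] of the circle
    R/Z. *)
Lemma random_tour_intercepts (c : closed_walk Q) (alpha t r : R) x :
  0 < alpha <= walk_length c -> 0 <= t -> tour_pos c r = x ->
  ((alpha / walk_length c)%:E <=
    random_tour c [set S | intercepts alpha S (x, t)])%E.
Proof.
move=> /andP[a0 aL] t0 cx; set L := walk_length c.
have L0 : 0 < L by exact: lt_le_trans aL.
apply: (@uniform_prob_arc ((r - t - alpha) / L)).
- by rewrite divr_ge0 ?(ltW a0) ?(ltW L0)//= ler_pdivrMr// mul1r.
- rewrite -[X in measurable X]setTI; apply: measurable_tour_patrol => //.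
  have := measurable_ysection (x, t)
    (measurable_interceptions Q_complete (ltW a0)).
  congr (measurable _); apply/seteqP; split=> S; rewrite /ysection/= inE.
    by case.
  by move=> ?; split.
move=> u k u01 /andP[]; rewrite -mulrDl (addrNK alpha).
rewrite ler_pdivrMr// ler_pdivlMr// => h1 h2 /=.
exists (r - L * k%:~R - L * u) => /=; first lra.
by rewrite addrC subrK -cx -(tour_pos_periodic _ k L0) -/L subrK.
Qed.

End Patroller.

(** * Lengths of the factors and the guarantee of the mixed strategy *)

Section Factorization.
Local Open Scope classical_set_scope.
Context {R : realType} (Q : network R).

Lemma arcs_lengthC (M : {set arcs Q}) :
  arcs_length (~: M)%SET = total_length Q - arcs_length M.
Proof.
apply/esym/eqP; rewrite subr_eq addrC; apply/eqP.
rewrite /total_length /arcs_length [LHS](bigID (mem M))/=.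
by congr (_ + _); apply: eq_bigl => a; rewrite !inE.
Qed.

Context (k : nat) (F : 'I_k -> {set arcs Q}).
Hypothesis F_factorization : one_factorization F.

Lemma factor_uniq (a : arcs Q) (i j : 'I_k) : a \in F i -> a \in F j -> i = j.
Proof.
have [_ dF _] := F_factorization => ai aj; apply/eqP/negPn/negP => /dF.
by move=> /disjointFr/(_ ai); rewrite aj.
Qed.

Lemma sum_factor_length : \sum_i arcs_length (F i) = total_length Q.
Proof.
have [_ _ cF] := F_factorization.
rewrite /total_length /arcs_length.
under eq_bigr do rewrite big_mkcond.
rewrite exchange_big/= [RHS]big_mkcond/=; apply: eq_bigr => a _.
have [i ai] := cF a; rewrite inE (bigD1 i)//= ai big1 ?addr0// => j ji.
by case: ifP => // /(factor_uniq ai) ij; rewrite ij eqxx in ji.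
Qed.

(** Each arc lies in all complements but one. For [k = 2 * n - 1] with [n >= 2] this makes the
    weights sum to 1. *)
Lemma sum_factorC_length :
  \sum_i arcs_length (~: F i)%SET = (k%:R - 1) * total_length Q.
Proof.
under eq_bigr do rewrite arcs_lengthC.
by rewrite sumrB sum_factor_length sumr_const card_ord mulrBl mul1r mulr_natl.
Qed.

Lemma le_factorC_length (alpha : R) (i : 'I_k) :
  alpha <= total_length Q - max_factor_length F ->
  alpha <= arcs_length (~: F i)%SET.
Proof.
move=> /le_trans; apply; rewrite arcs_lengthC lerB//.
exact: (le_bigmax _ (fun i => arcs_length (F i))).
Qed.

Lemma eulerian_tour_length (H : {set arcs Q}) (c : closed_walk Q) :
  eulerian_tour H c -> walk_length c = arcs_length H.
Proof.
move=> [uc cH]; rewrite /walk_length -(big_map fst xpredT (fun a => len a)).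
by rewrite big_uniq//=; apply: eq_bigl => a; exact: cH.
Qed.

Hypothesis Q_complete : complete_network Q.

Lemma complete_network_strategy_optimal (n : nat) (alpha : R)
    (c : 'I_k -> closed_walk Q) : k = (2 * n - 1)%N -> (1 < n)%N ->
  0 < alpha -> (forall i, alpha <= arcs_length (~: F i)%SET) ->
  (forall i, eulerian_tour (~: F i)%SET (c i)) ->
  patroller_optimal alpha (alpha / total_length Q)
    (complete_network_strategy n F c).
Proof.
move=> kE n1 a0 aF tour; have [pF _ cF] := F_factorization.
have k0 : (0 < k)%N by lia.
have N0 : 0 < (2 * n - 2)%:R :> R by rewrite ltr0n; lia.
have kN : k%:R - 1 = (2 * n - 2)%:R :> R.
  by rewrite -[1]/(1%:R) -natrB//; congr _%:R; lia.
have F0 i : 0 < arcs_length (~: F i)%SET by exact: lt_le_trans (aF i).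
have mu0 : 0 < total_length Q.
  by have := F0 (Ordinal k0); rewrite arcs_lengthC; have := arcs_length_ge0 (F (Ordinal k0)); lra.
have stratE A : complete_network_strategy n F c A =
  (\sum_i (factor_weight n (F i))%:E * random_tour (c i) A)%E by [].
split.
  rewrite /mixed_patrols /= stratE.
  rewrite (eq_bigr (fun i => (factor_weight n (F i))%:E)) => [|i _].
    rewrite sumEFin /factor_weight -mulr_suml sum_factorC_length kN divff//.
    by rewrite mulf_neq0// gt_eqF.
  by rewrite -[RHS]mule1; congr (_ * _)%E; exact: probability_setT.
move=> [x t] t0; rewrite /patrol_payoff /= stratE.
have [v|a [s [sa xE]]] := point_on_arc x.
  have /eqP/cards1P[a aE] := pF (Ordinal k0) v; exists a.
  by have /[!inE]/andP[] : a \in [set a in F (Ordinal k0) | incident v a]%SET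
    by rewrite aE inE.
have [i0 ai0] := cF a.
(* Only the tour of the complement of [F i0] may miss the arc [a]; its term is bounded below by 0,
   and [2 * n - 2] equal terms remain. *)
rewrite (bigD1 i0)//=; apply: (@le_trans _ _
    (0 + \sum_(i < k | i != i0) (alpha / ((2 * n - 2)%:R * total_length Q))%:E)%E).
  rewrite add0e sumEFin lee_fin sumr_const cardC1 card_ord -[leRHS]mulr_natl.
  have -> : k.-1 = (2 * n - 2)%N by lia.
  by rewrite invfM mulrCA mulVKf// gt_eqF.
apply: leeD; first by rewrite mule_ge0// lee_fin factor_weight_ge0.
apply: lee_sum => i ii0.
have ai : a \in map fst (darts (c i)).
  rewrite (tour i).2 inE; apply/negP => /(factor_uniq ai0) ij.
  by rewrite ij eqxx in ii0.
have [r rx] := tour_visits ai sa.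
have wE := eulerian_tour_length (tour i).
have := @random_tour_intercepts _ _ Q_complete (c i) alpha t r x.
rewrite wE a0 aF xE => /(_ isT t0 rx) h.
apply: le_trans (lee_wpmul2l _ h); last by rewrite lee_fin factor_weight_ge0.
(* The length of the sub-network cancels between its weight and its interception probability. *)
by rewrite -EFinM lee_fin /factor_weight [leRHS]mulrC mulrA divfK// gt_eqF.
Qed.

End Factorization.

(** * Eulerian tours *)

Section Euler.
Context {R : realType} (Q : network R) (H : {set arcs Q}).

Let step : rel (dart Q) := [rel e e' | dtgt e == dsrc e'].

Definition arc_adjacent : rel (node Q) :=
  [rel u v | [exists a, (a \in H) && joins a u v]].

Hypothesis loopless : forall a, a \in H -> src a != tgt a.
Hypothesis even_degree : forall v, ~~ odd #|[set a in H | incident v a]|.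
Hypothesis H_connected : forall u v, connect arc_adjacent u v.

Definition trail (c : seq (dart Q)) : bool :=
  [&& sorted step c, uniq (map fst c) & all (mem H) (map fst c)].

Lemma trail_rcons e c f : trail (e :: c) -> dtgt (last e c) = dsrc f ->
  f.1 \in H -> f.1 \notin map fst (e :: c) -> trail (e :: rcons c f).
Proof.
move=> /and3P[/= pc uc ac] cf fH fc.
apply/and3P; split; rewrite -?rcons_cons ?map_rcons ?rcons_uniq ?fc ?all_rcons.
- by rewrite /= rcons_path pc; apply/eqP.
- exact: uc.
- by rewrite /= fH.
Qed.

Lemma incident_dart v (e : dart Q) : src e.1 != tgt e.1 ->
  incident v e.1 = (dsrc e == v) (+) (dtgt e == v).
Proof.
rewrite /incident /dsrc /dtgt => st.
have : ~~ ((src e.1 == v) && (tgt e.1 == v)).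
  by apply: contraNN st => /andP[/eqP -> /eqP ->].
by case: e.2; do 2 case: (_ == v).
Qed.

(** Each passage of the trail through [v] contributes two incidences, which cancel modulo 2; only
    the two ends of the trail remain. *)
Lemma trail_parity v e c : trail (e :: c) ->
  odd (count (incident v) (map fst (e :: c))) =
  (dsrc e == v) (+) (dtgt (last e c) == v).
Proof.
elim: c e => [|f c IH] e /and3P[/= pc uc /andP[eH ac]].
  by rewrite addn0 oddb incident_dart// loopless.
rewrite oddD oddb IH; last first.
  by move/andP: pc uc => [_ pc] /andP[_ uc]; apply/and3P.
have /andP[/eqP ef _] := pc.
by rewrite incident_dart ?loopless// ef addbA -[X in X (+) _]addbA addbb addbF.
Qed.

Lemma dart_from (v : node Q) (a : arcs Q) : incident v a ->
  exists2 f : dart Q, f.1 = a & dsrc f = v.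
Proof. by case/orP => /eqP <-; [exists (a, true)|exists (a, false)]. Qed.

(** An open trail has used an odd number of arcs at its final node; the degree there is even, so an
    arc is left to continue along. *)
Lemma trail_open_extend e c : trail (e :: c) -> dtgt (last e c) != dsrc e ->
  exists f, trail (e :: rcons c f).
Proof.
move=> tc ce; set v := dtgt (last e c).
have [/existsP[a /and3P[aH av ac]]|] :=
    boolP [exists a, [&& a \in H, incident v a & a \notin map fst (e :: c)]].
  have [f fa fv] := dart_from av.
  by exists f; apply: trail_rcons; rewrite ?fa.
rewrite negb_exists => /forallP all_used.
have := trail_parity v tc; rewrite eqxx eq_sym (negbTE ce) => odd_c.
have /and3P[_ uc /allP ac] := tc.
suff E : count (incident v) (map fst (e :: c)) = #|[set a in H | incident v a]|.
  by have := even_degree v; rewrite -E odd_c.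
rewrite -size_filter -(card_uniqP (filter_uniq _ uc)).
apply: eq_card => a; rewrite mem_filter inE.
have := all_used a; case: (incident v a); rewrite ?andbF //= andbT.
have [aH|aH _] := boolP (a \in H); first by rewrite negbK => ->.
by apply/negP => /ac; exact/negP.
Qed.

(* Connectedness gives an unused arc at a visited node, and the closed trail can
   be rotated to end there. *)
Lemma trail_closed_extend e c a : trail (e :: c) -> dtgt (last e c) = dsrc e ->
  a \in H -> a \notin map fst (e :: c) ->
  exists e' c', trail (e' :: c') /\ size c' = (size c).+1.
Proof.
move=> tc ce aH ac; set s := e :: c in tc ac.
have cyc : cycle step s.
  by have /and3P[pc _ _] := tc; rewrite /s/= rcons_path; apply/andP; split; [exact: pc|exact/eqP].
have [/existsP[b /and3P[bH bs /hasP[e' e's bv]]]|] := boolP [exists b,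
    [&& b \in H, b \notin map fst s & has (fun e' => incident (dsrc e') b) s]].
  have [f fb fv] := dart_from bv.
  have [i c' rotE] := rot_to e's.
  have cyc' : cycle step (e' :: c') by rewrite -rotE rot_cycle.
  exists e', (rcons c' f); split; last first.
    rewrite size_rcons; congr S; apply: succn_inj.
    by rewrite -[LHS]/(size (e' :: c')) -rotE size_rot.
  move: cyc'; rewrite /= rcons_path => /andP[pc' /eqP ce'].
  apply: trail_rcons; rewrite ?fb ?ce' ?fv//.
    have /and3P[_ us as_] := tc; apply/and3P; split=> //.
      by rewrite -rotE map_rot rot_uniq.
    by rewrite -rotE map_rot; apply/allP => x; rewrite mem_rot; exact/allP.
  by rewrite -rotE map_rot mem_rot.
rewrite negb_exists => /forallP all_used; exfalso.
pose W := [pred v | v \in map (@dsrc _ Q) s].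
have tW f : f \in s -> dtgt f \in W.
  move=> fs; have /eqP := next_cycle cyc fs => ->.
  by apply: map_f; rewrite mem_next.
have adjW u v : arc_adjacent u v -> u \in W -> v \in W.
  move=> /existsP[b /andP[bH buv]] /mapP[g gs ug].
  have := all_used b; rewrite bH andTb negb_and negbK => /orP[|]; last first.
    move=> /hasPn h; have := h _ gs; rewrite -ug /incident.
    by case/orP: buv => /andP[e1 e2]; rewrite ?e1 ?e2 ?orbT.
  move=> /mapP[f fs bf].
  have [->|->] : v = dsrc f \/ v = dtgt f; [|exact: map_f|exact: tW].
  rewrite /dsrc /dtgt -bf.
  by move: buv; case: f.2 => /orP[|] /andP[/eqP ? /eqP ?]; [right|left|left|right].
have adjC u v : arc_adjacent u v = arc_adjacent v u.
  by apply: eq_existsb => b; rewrite /joins orbC.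
have clW : closed_mem arc_adjacent (mem W).
  by move=> u v uv; apply/idP/idP; apply: adjW => //; rewrite adjC.
have : src a \in W.
  rewrite -(closed_connect clW (H_connected (dsrc e) (src a))).
  by apply: map_f; rewrite mem_head.
move=> /mapP[g gs ga]; have := all_used a; rewrite aH ac !andTb => /hasPn h.
by have := h _ gs; rewrite /incident -ga eqxx.
Qed.

Lemma trail_extend e c : trail (e :: c) ->
  (exists c' : closed_walk Q, eulerian_tour H c') \/
  exists e' c', trail (e' :: c') /\ size c' = (size c).+1.
Proof.
move=> tc; have [ce|ce] := eqVneq (dtgt (last e c)) (dsrc e); last first.
  have [f tf] := trail_open_extend tc ce.
  by right; exists e, (rcons c f); rewrite size_rcons.
have [|] := boolP [exists a, (a \in H) && (a \notin map fst (e :: c))].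
  by move=> /existsP[a /andP[aH ac]]; right; exact: trail_closed_extend ce aH ac.
rewrite negb_exists => /forallP all_used; left.
have /and3P[pc uc /allP ac] := tc.
have cyc : cycle step (e :: c).
  by rewrite /= rcons_path; apply/andP; split; [exact: pc|exact/eqP].
exists (ClosedWalk cyc); split=> //= a; apply/idP/idP; first exact: ac.
by move=> aH; have := all_used a; rewrite aH negbK.
Qed.

(** A trail that is not yet an Eulerian tour can be lengthened, and its arcs are distinct, so
    lengthening a one-dart trail must stop at a tour. *)
Theorem euler_tour : exists c : closed_walk Q, eulerian_tour H c.
Proof.
have [H0|[a aH]] := set_0Vmem H.
  by exists (@ClosedWalk _ Q [::] isT); split=> // a; rewrite H0 finset.in_set0.
have t1 : trail [:: (a, true)] by rewrite /trail /= aH.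
(* [m] bounds the number of extensions left; since the trail has [(size c).+1] arcs, [m = 0] is
   impossible. *)
suff ext m e c : trail (e :: c) -> (#|arcs Q| - size c <= m)%N ->
    exists c : closed_walk Q, eulerian_tour H c by exact: ext t1 (leqnn _).
elim: m e c => [|m IH] e c tc.
  have /and3P[_ uc _] := tc; have := max_card (mem (map fst (e :: c))).
  rewrite (card_uniqP uc) size_map leqn0 subn_eq0 => h1 h2.
  by have := leq_trans h1 h2; rewrite ltnn.
have [//|[e' [c' [tc' sc']]]] := trail_extend tc.
by move=> cm; apply: (IH e' c') => //; rewrite sc'; lia.
Qed.

End Euler.

(** * Complements of factors *)

Section FactorComplement.
Context {R : realType} (Q : network R) (k : nat) (F : 'I_k -> {set arcs Q}).
Hypotheses (F_factorization : one_factorization F) (Q_complete : complete_network Q).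

(** Each factor has exactly one arc [f j] at [v]. These arcs are distinct and exhaust the arcs at
    [v], and deleting [F i] removes only [f i]. *)
Lemma degree_factorC (i : 'I_k) (v : node Q) :
  #|[set a in (~: F i)%SET | incident v a]| = k.-1.
Proof.
have [pF _ cF] := F_factorization.
have [f fP] : exists f : 'I_k -> arcs Q,
    forall j, [set a in F j | incident v a] = [set f j].
  have ex j : exists a, [set a in F j | incident v a] == [set a].
    by have /eqP/cards1P[a ->] := pF j v; exists a.
  by exists (fun j => xchoose (ex j)) => j; exact/eqP/(xchooseP (ex j)).
have fF j a : (a \in F j) && incident v a = (a == f j).
  by have /setP/(_ a) := fP j; rewrite !inE.
have finj : injective f.
  move=> j j' ff; have := fF j (f j); have := fF j' (f j); rewrite ff !eqxx.
  by move=> /andP[j'f _] /andP[jf _]; exact: (factor_uniq F_factorization jf j'f).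
rewrite -[k in RHS]card_ord -(cardC1 i) -(card_imset _ finj).
apply: eq_card => a; rewrite !inE; apply/andP/imsetP => [[aFi av]|[j ji ->]].
  have [j aj] := cF a; exists j; last by apply/eqP; rewrite -fF aj.
  by rewrite inE; apply: contraNneq aFi => <-.
have := fF j (f j); rewrite eqxx => /andP[fj ->]; split=> //.
apply/negP => /(factor_uniq F_factorization fj) ij.
by rewrite !inE ij eqxx in ji.
Qed.

(** If the arc between [u] and [v] was deleted, it is the only deleted arc at [u] and at [v], so the
    detour through any third node [w] survives. *)
Lemma factorC_connected (i : 'I_k) (u v : node Q) : (2 < #|node Q|)%N ->
  connect (arc_adjacent (~: F i)%SET) u v.
Proof.
move=> node3; have [_ simple] := Q_complete; have [pF _ _] := F_factorization.
have [->|uv] := eqVneq u v; first exact: connect0.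
have arc x y : x != y -> exists a : arcs Q, joins a x y.
  move=> /simple/eqP/cards1P[a aE]; exists a.
  have : a \in [set a] by rewrite inE.
  by rewrite -aE inE.
have joinC (a : arcs Q) x y : joins a x y = joins a y x by rewrite /joins orbC.
have inc (a : arcs Q) x y : joins a x y -> incident x a.
  by rewrite /incident => /orP[|] /andP[h1 h2]; rewrite ?h1 ?h2 ?orbT.
have [a auv] := arc u v uv.
have [aF|aF] := boolP (a \in F i); last first.
  by apply: connect1; apply/existsP; exists a; rewrite inE aF.
have only b x y : x \in [:: u; v] -> joins b x y -> b \in F i -> b = a.
  move=> xuv bxy bF; have /eqP/cards1P[c cE] := pF i x.
  have xa : incident x a.
    by move: xuv; rewrite !inE => /orP[] /eqP ->; [exact: (inc _ _ _ auv)|apply: (inc a v u); rewrite joinC].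
  have : b \in [set c] by rewrite -cE inE bF (inc _ _ _ bxy).
  have : a \in [set c] by rewrite -cE inE aF.
  by rewrite !inE => /eqP -> /eqP.
have [w /andP[wu wv]] : exists w, (w != u) && (w != v).
  have : (0 < #|~: [set u; v]|)%N.
    by rewrite cardsCs finset.setCK cards2 uv; lia.
  by move=> /card_gt0P[w]; rewrite !inE negb_or => ?; exists w.
have adjw x y : x \in [:: u; v] -> x != w -> (y = w) -> arc_adjacent (~: F i)%SET x y.
  move=> xuv xw ->; have [b bxw] := arc x w xw.
  apply/existsP; exists b; rewrite inE bxw andbT; apply/negP => /(only _ _ _ xuv bxw) ba.
  have : incident w a by apply: (inc a w x); rewrite joinC -ba.
  case/orP: auv => /andP[/eqP e1 /eqP e2];
    by rewrite /incident e1 e2 ![_ == w]eq_sym (negbTE wu) (negbTE wv).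
apply: (@connect_trans _ _ w); apply: connect1.
  by apply: adjw => //; rewrite ?mem_head// eq_sym.
have := adjw v w; rewrite !inE eqxx orbT eq_sym => /(_ isT wv erefl).
by move=> /existsP[b bvw]; apply/existsP; exists b; rewrite joinC.
Qed.

End FactorComplement.

(** * Assembling the solution of the game *)

Theorem proposition14 (R : realType) (n : nat) (n_gt0 : (0 < n)%N)
    (Q : network R) (Q_complete : complete_network Q)
    (Q_nodes : #|node Q| = (2 * n)%N)
    (F : 'I_(2 * n - 1) -> {set arcs Q}) (F_factorization : one_factorization F)
    (alpha : R) (alpha_gt0 : 0 < alpha)
    (alpha_le_cover : forall w : closed_walk Q,
        covering w -> alpha <= walk_length w)
    (alpha_le : alpha <= total_length Q - max_factor_length F) :
  let V := alpha / total_length Q in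
  [/\ game_value Q alpha V,
      (exists c : 'I_(2 * n - 1) -> closed_walk Q,
          forall i, eulerian_tour (~: F i)%SET (c i)),
      (forall c : 'I_(2 * n - 1) -> closed_walk Q,
          (forall i, eulerian_tour (~: F i)%SET (c i)) ->
          patroller_optimal alpha V (complete_network_strategy n F c)) &
      (forall t : R, 0 <= t ->
          attacker_optimal alpha V (uniform_attack Q t))].
Proof.
move=> V; have aF i := le_factorC_length i alpha_le.
have n1 : (1 < n)%N.
  (* For [n = 1] the single factor is the whole network, so the bound on [alpha] would force
     [alpha <= 0]. *)
  rewrite ltnNge; apply/negP => n1; have {n1}n1 : n = 1%N by lia.
  subst n; have := aF ord0; have := sum_factor_length F_factorization.
  by rewrite arcs_lengthC big_ord1 => <-; rewrite subrr; lra.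
have mu0 : 0 < total_length Q.
  have i0 : 'I_(2 * n - 1) by exists 0%N; lia.
  by have := aF i0; rewrite arcs_lengthC; have := arcs_length_ge0 (F i0); lra.
have tours i : exists c : closed_walk Q, eulerian_tour (~: F i)%SET c.
  apply: euler_tour => [a _|v|u v].
  - by have [] := Q_complete.
  - rewrite degree_factorC// (_ : (_ - 1).-1 = (n.-1).*2) ?odd_double//; lia.
  - by apply: factorC_connected => //; rewrite Q_nodes; lia.
have [c0 c0P] : exists c : 'I_(2 * n - 1) -> closed_walk Q,
    forall i, eulerian_tour (~: F i)%SET (c i).
  by exists (fun i => projT1 (cid (tours i))) => i; exact: projT2 (cid (tours i)).
have pat c : (forall i, eulerian_tour (~: F i)%SET (c i)) ->
    patroller_optimal alpha V (complete_network_strategy n F c).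
  exact: complete_network_strategy_optimal.
have att t : 0 <= t -> attacker_optimal alpha V (uniform_attack Q t).
  exact: uniform_attack_optimal.
split=> //; last by exists c0.
(* Any one optimal pair determines the value; the tours [c0] and start time 0 are chosen. *)
exact: game_value_optimal (ltW alpha_gt0) (pat _ c0P) (att 0 (lexx 0)).
Qed.
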